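(* Let $r,R>0$ satisfy $r>\overline{H}(\mathbf{X}|\mathbf{Y})$ and $r+R<\underline{H}(\mathbf{X})$. Then for every $\delta>0$ and all sufficiently large $n$ there exist functions $A\in\mathcal{A}_n$, $B\in\mathcal{B}_n$ and a vector $\mathbf{c}\in\mathrm{Im}\mathcal{A}_n$ such that $\mathrm{Error}(A,B,\mathbf{c})\le\delta$.
   Context: Logarithms base 2. $\mathcal{X}$ is a finite set (channel input alphabet); $\mathcal{Y}^n$ is an arbitrary output alphabet. $\mathbf{W}=\{\mu_{Y^n|X^n}\}$ is a general channel and $\mathbf{X}=\{X^n\}$ a general source on $\mathcal{X}^n$ with distributions $\mu_{X^n}$; $(X^n,Y^n)$ has joint law $\mu_{Y^n|X^n}(\mathbf{y}|\mathbf{x})\mu_{X^n}(\mathbf{x})$ and $\mu_{X^n|Y^n}$ is the induced conditional distribution. $\underline{H}(\mathbf{X})=\sup\{\theta:\lim_nP(\frac1n\log\frac1{\mu_{X^n}(X^n)}<\theta)=0\}$, $\overline{H}(\mathbf{X}|\mathbf{Y})=\inf\{\theta:\lim_nP(\frac1n\log\frac1{\mu_{X^n|Y^n}(X^n|Y^n)}>\theta)=0\}$. Ensembles and hash property: an ensemble is a sequence $\{(\mathcal{A}_n,p_{\mathsf{A},n})\}$ where $\mathcal{A}_n$ is a set of functions $A:\mathcal{X}^n\to\mathrm{Im}\mathcal{A}_n:=\bigcup_{A\in\mathcal{A}_n}\{A\mathbf{u}:\mathbf{u}\in\mathcal{X}^n\}$ and $p_{\mathsf{A},n}$ is a probability distribution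 on $\mathcal{A}_n$. It has an $(\boldsymbol\alpha,\boldsymbol\beta)$-hash property if there are sequences $\alpha(n)\to1$, $\beta(n)\to0$ such that for every $n$ and $\mathbf{u}\in\mathcal{X}^n$, $\sum p_{\mathsf{A},n}(\{A:A\mathbf{u}=A\mathbf{u}'\})\le\beta(n)$, the sum running over all $\mathbf{u}'\ne\mathbf{u}$ with $p_{\mathsf{A},n}(\{A:A\mathbf{u}=A\mathbf{u}'\})>\alpha(n)/|\mathrm{Im}\mathcal{A}_n|$. Setting: $\{(\mathcal{A}_n,p_{\mathsf{A},n})\}$ and $\{(\mathcal{B}_n,p_{\mathsf{B},n})\}$ are ensembles of functions on $\mathcal{X}^n$, each with some hash property, with $\frac1n\log|\mathrm{Im}\mathcal{A}_n|=r$ and $\frac1n\log|\mathrm{Im}\mathcal{B}_n|=R$. Let $\mathcal{M}_n=\mathrm{Im}\mathcal{B}_n$, $\mathcal{C}_A(\mathbf{c})=\{\mathbf{x}:A\mathbf{x}=\mathbf{c}\}$, $\mathcal{C}_{AB}(\mathbf{c},\mathbf{m})=\{\mathbf{x}:A\mathbf{x}=\mathbf{c},B\mathbf{x}=\mathbf{m}\}$. Stochastic encoder: on message $\mathbf{m}$, output a random $\mathbf{x}$ with distribution $\mu_{X^n}(\mathbf{x})/\mu_{X^n}(\mathcal{C}_{AB}(\mathbf{c},\mathbf{m}))$ on $\mathcal{C}_{AB}(\mathbf{c},\mathbf{m})$ (an encoding error is declared if $\mu_{X^n}(\mathcal{C}_{AB}(\mathbf{c},\mathbf{m}))=0$). Decoder: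 $\psi_n(\mathbf{y})=B\,\mathbf{x}_A(\mathbf{c}|\mathbf{y})$ with $\mathbf{x}_A(\mathbf{c}|\mathbf{y})=\arg\max_{\mathbf{x}'\in\mathcal{C}_A(\mathbf{c})}\mu_{X^n|Y^n}(\mathbf{x}'|\mathbf{y})$. Error probability: $\mathrm{Error}(A,B,\mathbf{c})=\sum_{\mathbf{m}:\mu_{X^n}(\mathcal{C}_{AB}(\mathbf{c},\mathbf{m}))=0}\frac1{|\mathcal{M}_n|}+\sum\frac{\mu_{Y^n|X^n}(\mathbf{y}|\mathbf{x})\mu_{X^n}(\mathbf{x})}{|\mathcal{M}_n|\mu_{X^n}(\mathcal{C}_{AB}(\mathbf{c},\mathbf{m}))}$, the second sum over $(\mathbf{m},\mathbf{x},\mathbf{y})$ with $\mu_{X^n}(\mathcal{C}_{AB}(\mathbf{c},\mathbf{m}))>0$, $\mathbf{x}\in\mathcal{C}_{AB}(\mathbf{c},\mathbf{m})$, $\psi_n(\mathbf{y})\ne\mathbf{m}$. *)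

(* Defs.v *)
From HB Require Import structures.
From mathcomp Require Import all_boot all_order all_algebra.
From mathcomp Require Import all_classical all_reals all_analysis.
Set Implicit Arguments. Unset Strict Implicit. Unset Printing Implicit Defensive.
Import Order.TTheory GRing.Theory Num.Theory numFieldNormedType.Exports.
Local Open Scope ring_scope.
Local Open Scope classical_set_scope.

Section Defs.
Variable R : realType.

Definition log2 (x : R) : R := ln x / ln 2.

Section Ensemble.
Variables (X : finType) (n : nat) (C : finType).
Variable (An : {set {ffun n.-tuple X -> C}}) (p : {ffun n.-tuple X -> C} -> R).

Definition ImEns : {set C} := [set (A : {ffun n.-tuple X -> C}) u | A in An, u in [set: n.-tuple X]].

Definition pcoll (u u' : n.-tuple X) : R :=
  \sum_(A in An | A u == A u') p A.

Definition is_distr_on : Prop :=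
  (forall A, A \in An -> 0 <= p A) /\ \sum_(A in An) p A = 1.

Definition hash_sum (alpha : R) (u : n.-tuple X) : R :=
  \sum_(u' | (u' != u) && (alpha / #|ImEns|%:R < pcoll u u')) pcoll u u'.
End Ensemble.

Definition ensemble (X : finType) (C : nat -> finType)
  (A : forall n, {set {ffun n.-tuple X -> C n}})
  (p : forall n, {ffun n.-tuple X -> C n} -> R) : Prop :=
  forall n, is_distr_on (A n) (p n).

Definition hash_property (X : finType) (C : nat -> finType)
  (A : forall n, {set {ffun n.-tuple X -> C n}})
  (p : forall n, {ffun n.-tuple X -> C n} -> R)
  (alpha beta : nat -> R) : Prop :=
  alpha @ \oo --> (1 : R) /\ beta @ \oo --> (0 : R) /\
  forall n (u : n.-tuple X), hash_sum (A n) (p n) (alpha n) u <= beta n.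

Definition has_hash_property (X : finType) (C : nat -> finType)
  (A : forall n, {set {ffun n.-tuple X -> C n}})
  (p : forall n, {ffun n.-tuple X -> C n} -> R) : Prop :=
  exists alpha beta, hash_property A p alpha beta.

Definition is_source (X : finType) (mu : forall n, n.-tuple X -> R) : Prop :=
  forall n, (forall x, 0 <= mu n x) /\ \sum_x mu n x = 1.

Definition Hinf (X : finType) (mu : forall n, n.-tuple X -> R) : \bar R :=
  ereal_sup [set th%:E | th in
    [set th : R | (fun n => \sum_(x | (n%:R)^-1 * log2 (mu n x)^-1 < th) mu n x)
                    @ \oo --> (0 : R)]].

(** For each n the output alphabet Y n is an arbitrary measurable space with
    a reference measure nu n; the channel mu_{Y^n|X^n}(y|x) is the density
    W n x y with respect to nu n (sums over y are integrals d(nu n)). *)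
Section Channel.
Variables (X : finType) (dY : nat -> measure_display)
  (Y : forall n, measurableType (dY n))
  (nu : forall n, {measure set (Y n) -> \bar R})
  (W : forall n, n.-tuple X -> Y n -> R)
  (mu : forall n, n.-tuple X -> R).

Definition is_channel : Prop :=
  forall n (x : n.-tuple X),
    measurable_fun setT (W x) /\ (forall y, 0 <= W x y) /\
    (\int[nu n]_y (W x y)%:E = 1)%E.

Definition muY n (y : Y n) : R := \sum_x W x y * mu x.

Definition muXgY n (x : n.-tuple X) (y : Y n) : R := W x y * mu x / muY y.

Definition Pjoint n (E : n.-tuple X -> Y n -> Prop) : \bar R :=
  (\sum_x (mu x)%:E * \int[nu n]_(y in [set y | E x y]) (W x y)%:E)%E.

Definition HsupCond : \bar R :=
  ereal_inf [set th%:E | th in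
    [set th : R | (fun n => @Pjoint n (fun x y =>
                     th < (n%:R)^-1 * log2 (muXgY x y)^-1)) @ \oo --> 0%E]].

Variables (CA CB : nat -> finType).

Section Code.
Variables (n : nat) (A : {ffun n.-tuple X -> CA n}) (B : {ffun n.-tuple X -> CB n})
  (c : CA n) (M : {set CB n}).

Definition CAset : {set n.-tuple X} := [set x | A x == c].
Definition CABset (m : CB n) : {set n.-tuple X} := [set x | (A x == c) && (B x == m)].

Definition muset (S : {set n.-tuple X}) : R := \sum_(x in S) mu x.

Definition xA (y : Y n) : option (n.-tuple X) :=
  if [pick x in CAset] is Some x0 then
    Some [arg max_(x > x0 in CAset) muXgY x y]%O
  else None.

Definition psi (y : Y n) : option (CB n) := omap B (xA y).

(** error probability Error(A,B,c), with message set M = Im B_n *)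
Definition Error : \bar R :=
  ((\sum_(m in M | muset (CABset m) == 0) (#|M|%:R)^-1)%:E +
   \sum_(m in M | (0 < muset (CABset m))%R) \sum_(x in CABset m)
     \int[nu n]_(y in [set y | psi y <> Some m])
        (W x y * mu x / (#|M|%:R * muset (CABset m)))%:E)%E.
End Code.
End Channel.
End Defs.

(* Main.v *)
(** Random coding with [A], [B] and [c] drawn at random. Write [p(c,m)] for the
    source probability of the bin [A x = c, B x = m] and [K = |Im A| |Im B|].
    Replacing the encoder weight [1 / (|Im B| p(c,m))] by [|Im A|] costs at most
    [\sum_(c,m) |p(c,m) - 1/K|] on average over [c], and leaves the probability
    that the decoder of [X] from [(A X, Y)] is wrong.  The hash property bounds
    the expected [L^1] deviation through the second moment of the bins of the
    source truncated to [mu x <= 2^(-n theta)], with [theta > r + R].  It also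
    bounds the probability that some [x'] at least as likely as [x] given [y]
    satisfies [A x = A x']: when [mu(x|y) >= 2^(-n theta)] there are at most
    [2^(n theta)] such [x'], and here [theta < r]. *)
Require Import Defs.
From HB Require Import structures.
From mathcomp Require Import all_boot all_order all_algebra.
From mathcomp Require Import all_classical all_reals all_analysis.
From mathcomp Require Import measurable_realfun ring lra.
Set Implicit Arguments. Unset Strict Implicit. Unset Printing Implicit Defensive.
Import Order.TTheory GRing.Theory Num.Theory numFieldNormedType.Exports.
Local Open Scope ring_scope.
Local Open Scope classical_set_scope.

(** * Distance to uniform of the bin masses, for one fixed binning *)

Section Binning.
Variables (R : realType) (T Z : finType) (h : T -> Z) (I : {set Z}).
Hypothesis hI : forall x, h x \in I.

Definition mass (f : T -> R) (z : Z) : R := \sum_(x | h x == z) f x.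

Lemma sum_fibers (F : T -> R) :
  \sum_(z in I) \sum_(x | h x == z) F x = \sum_x F x.
Proof.
by rewrite [RHS](partition_big h (mem I)) => [|x _]; [exact: eq_bigr|exact: hI].
Qed.

(** Squaring a mass counts ordered pairs sharing a bin, so the second moment is a collision sum, the
    quantity that the hash property controls. *)
Lemma sum_mass_sqr f :
  \sum_(z in I) mass f z ^+ 2 = \sum_x \sum_(x' | h x == h x') f x * f x'.
Proof.
rewrite -[RHS](sum_fibers (fun x => \sum_(x' | h x == h x') f x * f x')).
apply: eq_bigr => z _; rewrite expr2 {1}/mass mulr_suml.
apply: eq_bigr => x /eqP <-; rewrite -mulr_sumr; congr (_ * _).
by apply: eq_bigl => x'; rewrite eq_sym.
Qed.

Lemma mass_ge0 f z : (forall x, 0 <= f x) -> 0 <= mass f z.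
Proof. by move=> f0; apply: sumr_ge0. Qed.

(** The numerator over [t] is a variance: the masses sum to [\sum_x f x], so the cross terms
    collapse. Optimising the free [t] would give its square root. *)
Lemma mass_deviation f t : (0 < #|I|)%N -> 0 < t ->
  \sum_(z in I) `|mass f z - (\sum_x f x) / #|I|%:R| <=
  ((#|I|%:R * (\sum_x \sum_(x' | h x == h x') f x * f x') -
    (\sum_x f x) ^+ 2) / t + t) / 2.
Proof.
rewrite -(ltr_nat R) => K0 t0; set K := #|I|%:R; set F := \sum_x f x.
have Kn0 : K != 0 by rewrite gt_eqF.
(* AM-GM term by term replaces Cauchy-Schwarz and avoids square roots. *)
have amgm d : `|d| <= (K * d ^+ 2 / t + t / K) / 2.
  rewrite -subr_ge0 -(real_normK (num_real d)).
  have -> : (K * `|d| ^+ 2 / t + t / K) / 2 - `|d| =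
    (K * `|d| - t) ^+ 2 / (2 * K * t).
    by field; rewrite Kn0 gt_eqF.
  by rewrite divr_ge0 ?sqr_ge0// !mulr_ge0// ltW.
apply: (le_trans (ler_sum _ (fun z _ => amgm _))).
rewrite -mulr_suml big_split /= sumr_const -[t / K *+ _]mulr_natr -/K divfK//.
rewrite ler_pM2r ?invr_gt0// lerD2r -mulr_suml ler_pM2r ?invr_gt0//.
rewrite -mulr_sumr -sum_mass_sqr.
under eq_bigr do rewrite sqrrB -mulrnAr.
rewrite big_split/= sumrB sumr_const -mulr_suml.
have -> : \sum_(z in I) mass f z = F by rewrite /mass sum_fibers.
rewrite -[_ *+ #|_|]mulr_natr -/K; set S := \sum_(z in I) _.
suff -> : K * (S - F * (F / K *+ 2) + (F / K) ^+ 2 * K) = K * S - F ^+ 2 by [].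
by field.
Qed.

(** Truncating [mu] to [f] costs the lost mass twice: once inside the bins, once for moving the
    uniform target from total 1 to total [F]. *)
Lemma mass_deviation_le (mu f : T -> R) : (0 < #|I|)%N ->
  (forall x, 0 <= f x <= mu x) -> \sum_x mu x = 1 ->
  \sum_(z in I) `|mass mu z - #|I|%:R^-1| <=
  2 * (1 - \sum_x f x) + \sum_(z in I) `|mass f z - (\sum_x f x) / #|I|%:R|.
Proof.
rewrite -(ltr_nat R) => K0 fmu mu1; set K := #|I|%:R; set F := \sum_x f x.
have F1 : F <= 1 by rewrite -mu1; apply: ler_sum => x _; case/andP: (fmu x).
have dev z : `|mass mu z - K^-1| <=
    (mass mu z - mass f z) + (1 - F) / K + `|mass f z - F / K|.
  have -> : mass mu z - K^-1 =
    (mass mu z - mass f z) - (1 - F) / K + (mass f z - F / K).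
    by field; rewrite gt_eqF.
  have h1 : 0 <= mass mu z - mass f z.
    by rewrite subr_ge0; apply: ler_sum => x _; case/andP: (fmu x).
  have h2 : 0 <= (1 - F) / K by rewrite divr_ge0 ?subr_ge0// ltW.
  apply: (le_trans (ler_normD _ _)); rewrite lerD2r.
  by apply: (le_trans (ler_normB _ _)); rewrite !ger0_norm.
apply: (le_trans (ler_sum _ (fun z _ => dev z))).
rewrite big_split lerD2r big_split/= sumrB sumr_const.
rewrite /mass !sum_fibers mu1 -/F -[_ *+ #|_|]mulr_natr divfK ?gt_eqF//.
by rewrite mulr_natl mulr2n.
Qed.

(** Per bin of mass [p], replacing [s / (K p)] by [s] changes it by [(p - 1/K) (s/p)], where
    [s / p <= 1]. A bin of mass 0 contributes [1/K], exactly its own deviation. *)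
Lemma avg_cond_error (mu e : T -> R) : (0 < #|I|)%N ->
  (forall x, 0 <= mu x) -> (forall x, 0 <= e x <= 1) ->
  \sum_(z in I) #|I|%:R^-1 *
     (if mass mu z == 0 then 1
      else (\sum_(x | h x == z) mu x * e x) / mass mu z) <=
  \sum_x mu x * e x + \sum_(z in I) `|mass mu z - #|I|%:R^-1|.
Proof.
rewrite -(ltr_nat R) => K0 mu0 e01; set K := #|I|%:R.
rewrite -(sum_fibers (fun x => mu x * e x)) -big_split /=.
apply: ler_sum => z _; set s := \sum_(x | _) _; set p := mass mu z.
have s0 : 0 <= s.
  by apply: sumr_ge0 => x _; rewrite mulr_ge0//; case/andP: (e01 x).
have sp : s <= p.
  by apply: ler_sum => x _; rewrite ler_piMr//; case/andP: (e01 x).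
have Ki0 : 0 < K^-1 by rewrite invr_gt0.
case: eqVneq => [->|pn0].
  by rewrite mulr1 sub0r normrN gtr0_norm// lerDr.
have p0 : 0 < p by rewrite lt_neqAle eq_sym pn0/= mass_ge0.
have sp1 : s / p <= 1 by rewrite ler_pdivrMr ?mul1r.
have sp0 : 0 <= s / p by rewrite divr_ge0// ltW.
have -> : K^-1 * (s / p) = s - (p - K^-1) * (s / p).
  by field; rewrite pn0 gt_eqF.
rewrite lerD2l -mulNr; apply: (le_trans (ler_norm _)).
by rewrite normrM normrN (ger0_norm sp0) ler_piMr.
Qed.

End Binning.

(** * Collision sums for one ensemble *)

Section Collisions.
Variables (R : realType) (X : finType) (n : nat) (C : finType).
Local Notation T := (n.-tuple X).
Variables (An : {set {ffun T -> C}}) (p : {ffun T -> C} -> R).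
Hypothesis pP : is_distr_on An p.
Let K : R := #|ImEns An|%:R.

Lemma mem_ImEns A u : A \in An -> A u \in ImEns An.
Proof. by move=> AAn; apply: imset2_f => //; rewrite in_setT. Qed.

Lemma pcoll_ge0 u u' : 0 <= pcoll An p u u'.
Proof. by apply: sumr_ge0 => A /andP[AAn _]; exact: pP.1. Qed.

(** A higher threshold keeps fewer terms. This lets both ensembles share one constant in place of
    their own [alpha]. *)
Lemma hash_sum_le a a' u : a <= a' -> hash_sum An p a' u <= hash_sum An p a u.
Proof.
move=> aa'; rewrite /hash_sum big_mkcond [leRHS]big_mkcond/=.
apply: ler_sum => u' _; case: eqP => //= _; case: ltP => [lt'|_].
  by rewrite (le_lt_trans _ lt')// ler_wpM2r// invr_ge0.
by case: ifP => // _; exact: pcoll_ge0.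
Qed.

Lemma pcoll_le1 u u' : pcoll An p u u' <= 1.
Proof.
rewrite -pP.2 /pcoll big_mkcondr; apply: ler_sum => A AAn.
by case: ifP => // _; exact: pP.1.
Qed.

Lemma hash_sum_ge0 a u : 0 <= hash_sum An p a u.
Proof. by apply: sumr_ge0 => u' _; exact: pcoll_ge0. Qed.

(** Split at the hash threshold: collision probabilities below [a / K] are replaced by [a / K];
    above it the weights are replaced by [b], leaving [hash_sum]. *)
Lemma sum_pcoll_le (f : T -> R) a b u : 0 <= a -> 0 <= b ->
  (forall x, 0 <= f x <= b) ->
  \sum_(u' | u' != u) f u' * pcoll An p u u' <=
  a / K * \sum_u' f u' + b * hash_sum An p a u.
Proof.
move=> a0 b0 fb.
have aK0 : 0 <= a / K by rewrite divr_ge0.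
rewrite mulr_sumr [X in _ <= X + _](bigID (fun u' => u' != u))/= -addrA.
rewrite /hash_sum big_mkcondr mulr_sumr/= addrCA -big_split/=.
apply: ler_wpDl.
  by apply: sumr_ge0 => u' _; rewrite mulr_ge0//; case/andP: (fb u').
apply: ler_sum => u' _; case/andP: (fb u') => f0 fb'.
have pc0 := pcoll_ge0 u u'.
case: ltP => [_|le]; last by rewrite mulr0 addr0 mulrC ler_wpM2r.
by apply: ler_wpDl; [exact: mulr_ge0|rewrite ler_wpM2r].
Qed.

End Collisions.

(** * Independent random [A] and [B], and the selection of a good code *)

Section RandomBinning.
Variables (R : realType) (X : finType) (n : nat) (CA CB : finType).
Local Notation T := (n.-tuple X).
Variables (An : {set {ffun T -> CA}}) (pA : {ffun T -> CA} -> R).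
Variables (Bn : {set {ffun T -> CB}}) (pB : {ffun T -> CB} -> R).
Hypothesis pAP : is_distr_on An pA.
Hypothesis pBP : is_distr_on Bn pB.
Let KA : R := #|ImEns An|%:R.
Let KB : R := #|ImEns Bn|%:R.

Definition bin (A : {ffun T -> CA}) (B : {ffun T -> CB}) (x : T) := (A x, B x).

Definition bins := finset.setX (ImEns An) (ImEns Bn).

Lemma mem_bins A B x : A \in An -> B \in Bn -> bin A B x \in bins.
Proof. by move=> AAn BBn; rewrite finset.in_setX !mem_ImEns. Qed.

Definition expect (F : {ffun T -> CA} -> {ffun T -> CB} -> R) :=
  \sum_(A in An) \sum_(B in Bn) pA A * pB B * F A B.

Lemma expect_le F G :
  (forall A B, A \in An -> B \in Bn -> F A B <= G A B) -> expect F <= expect G.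
Proof.
move=> FG; apply: ler_sum => A AAn; apply: ler_sum => B BBn.
by rewrite ler_wpM2l ?FG// mulr_ge0 ?pAP.1 ?pBP.1.
Qed.

Lemma expectD F G :
  expect (fun A B => F A B + G A B) = expect F + expect G.
Proof.
rewrite /expect -big_split; apply: eq_bigr => A _; rewrite -big_split.
by apply: eq_bigr => B _; rewrite mulrDr.
Qed.

Lemma expectZ k F : expect (fun A B => k * F A B) = k * expect F.
Proof.
rewrite /expect mulr_sumr; apply: eq_bigr => A _; rewrite mulr_sumr.
by apply: eq_bigr => B _; rewrite mulrCA.
Qed.

Lemma expect_fst F : expect (fun A _ => F A) = \sum_(A in An) pA A * F A.
Proof.
apply: eq_bigr => A _; under eq_bigr do rewrite mulrAC.
by rewrite -mulr_sumr pBP.2 mulr1.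
Qed.

Lemma expect_cst k : expect (fun _ _ => k) = k.
Proof. by rewrite (expect_fst (fun=> k)) -mulr_suml pAP.2 mul1r. Qed.

Lemma expect_sum (J : finType) (P : pred J) F :
  expect (fun A B => \sum_(j | P j) F j A B) = \sum_(j | P j) expect (F j).
Proof.
rewrite /expect [RHS]exchange_big; apply: eq_bigr => A _.
rewrite [RHS]exchange_big; apply: eq_bigr => B _.
by rewrite mulr_sumr.
Qed.

Lemma expect_collision x x' :
  expect (fun A B => (bin A B x == bin A B x')%:R) =
  pcoll An pA x x' * pcoll Bn pB x x'.
Proof.
rewrite /pcoll big_mkcondr mulr_suml; apply: eq_bigr => A _.
rewrite mulr_sumr [RHS]big_mkcondr; apply: eq_bigr => B _.
rewrite /bin xpair_eqE; case: (A x == A x') => /=; last by rewrite mulr0 mul0r if_same.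
by case: (B x == B x'); rewrite ?mulr1 ?mulr0.
Qed.

Variables (f : T -> R) (a b : R) (bA bB : R).
Hypothesis f_bnd : forall x, 0 <= f x <= b.
Hypothesis a_ge0 : 0 <= a.
Hypothesis hashA : forall u, hash_sum An pA a u <= bA.
Hypothesis hashB : forall u, hash_sum Bn pB a u <= bB.

(** For fixed [x], the diagonal [x' = x] gives at most [b], ordinary pairs give the uniform term
    with [a ^+ 2 / (KA * KB)], and bad collisions of [An] and [Bn] give [a * b * bA] and
    [b * bB]. *)
Lemma expect_sum_collision :
  expect (fun A B =>
    \sum_x \sum_(x' | bin A B x == bin A B x') f x * f x') <=
  (\sum_x f x) * (b * (1 + a * bA + bB) + a ^+ 2 / (KA * KB) * \sum_x f x).
Proof.
have f0 x : 0 <= f x by case/andP: (f_bnd x).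
rewrite (@expect_sum _ predT (fun x A B =>
  \sum_(x' | bin A B x == bin A B x') f x * f x')) mulr_suml.
apply: ler_sum => x _.
have b0 : 0 <= b by have /andP[fx0] := f_bnd x; exact: le_trans.
have -> : expect (fun A B => \sum_(x' | bin A B x == bin A B x') f x * f x') =
    f x * \sum_x' f x' * (pcoll An pA x x' * pcoll Bn pB x x').
  rewrite mulr_sumr.
  under [RHS]eq_bigr do rewrite -expect_collision mulrA -expectZ.
  rewrite -expect_sum; congr expect; apply/funext => A; apply/funext => B.
  rewrite big_mkcond/=; apply: eq_bigr => x' _.
  by case: ifP; rewrite ?mulr1 ?mulr0.
rewrite ler_wpM2l// (bigD1 x)//=.
have diag : f x * (pcoll An pA x x * pcoll Bn pB x x) <= b.
  have /andP[_] := f_bnd x; apply: le_trans; rewrite ler_piMr// mulr_ile1//.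
  - exact: (pcoll_ge0 pAP x x).
  - exact: (pcoll_ge0 pBP x x).
  - exact: (pcoll_le1 pAP x x).
  - exact: (pcoll_le1 pBP x x).
(* Where [x'] is not a bad collision for [Bn] the hash property of [An] applies
   with weights scaled by [a / KB]; the bad ones are charged to [bB]. *)
have split x' : f x' * (pcoll An pA x x' * pcoll Bn pB x x') <=
    a / KB * (f x' * pcoll An pA x x') +
    (if a / KB < pcoll Bn pB x x' then b * pcoll Bn pB x x' else 0).
  have ca0 := pcoll_ge0 pAP x x'; have ca1 := pcoll_le1 pAP x x'.
  have cb0 := pcoll_ge0 pBP x x'.
  case: ltP => [_|le].
    apply: ler_wpDl; first by rewrite mulr_ge0 ?divr_ge0 ?mulr_ge0.
    case/andP: (f_bnd x') => _ fb; apply: ler_pM => //; first exact: mulr_ge0.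
    by rewrite ler_piMl.
  by rewrite addr0 mulrA mulrC ler_wpM2r// mulr_ge0.
have off : \sum_(x' | x' != x) f x' * (pcoll An pA x x' * pcoll Bn pB x x') <=
    a / KB * (a / KA * (\sum_x f x) + b * bA) + b * bB.
  apply: (le_trans (ler_sum _ (fun x' _ => split x'))).
  rewrite big_split/= -mulr_sumr -big_mkcondr/= -mulr_sumr; apply: lerD.
    rewrite ler_wpM2l ?divr_ge0//.
    apply: (le_trans (sum_pcoll_le pAP x a_ge0 b0 f_bnd)).
    by rewrite lerD2l ler_wpM2l.
  by rewrite ler_wpM2l//; exact: hashB.
apply: (le_trans (lerD diag off)).
have bA0 : 0 <= bA by apply: le_trans (hashA x); exact: hash_sum_ge0.
(* An empty image is harmless here because [0^-1 = 0]. *)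
have KB1 : KB^-1 <= 1.
  rewrite /KB; have [->|KB0] := posnP #|ImEns Bn|; first by rewrite invr0.
  by rewrite invf_le1 ?ltr0n// ler1n.
have : KB^-1 * (a * b * bA) <= 1 * (a * b * bA) by rewrite ler_wpM2r// !mulr_ge0.
rewrite invfM.
have -> : b * (1 + a * bA + bB) + a ^+ 2 * (KA^-1 * KB^-1) * (\sum_x f x) =
  b + (a / KB * (a / KA * (\sum_x f x)) + b * bB) + 1 * (a * b * bA) by ring.
move=> h.
have -> : b + (a / KB * (a / KA * (\sum_x f x) + b * bA) + b * bB) =
  b + (a / KB * (a / KA * (\sum_x f x)) + b * bB) + KB^-1 * (a * b * bA) by ring.
by rewrite lerD2l.
Qed.

Variable mu : T -> R.
Hypothesis mu_ge0 : forall x, 0 <= mu x.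
Hypothesis mu_sum1 : \sum_x mu x = 1.

(* [Error] with the decoding failure probability on input [x] replaced by [g x]. *)
Definition code_error (g : T -> R) A B c : R :=
  \sum_(m in ImEns Bn) KB^-1 *
    (if mass (bin A B) mu (c, m) == 0 then 1
     else (\sum_(x | bin A B x == (c, m)) mu x * g x) / mass (bin A B) mu (c, m)).

(** A uniform [c] and a uniform message make a uniform pair, so [avg_cond_error] applies to the
    joint binning [bin A B]. *)
Lemma avg_code_error g A B :
  \sum_(c in ImEns An) KA^-1 * code_error g A B c =
  \sum_(z in bins) #|bins|%:R^-1 *
    (if mass (bin A B) mu z == 0 then 1
     else (\sum_(x | bin A B x == z) mu x * g x) / mass (bin A B) mu z).
Proof.
under eq_bigr do rewrite /code_error mulr_sumr.
rewrite pair_big/=; apply: eq_big => [[c m]|[c m] _]; first by rewrite finset.in_setX.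
by rewrite mulrA -invfM -natrM finset.cardsX.
Qed.

(** First-moment argument: if every triple had error above [delta], the average over [A], [B] and
    uniform [c] would be at least [delta], against the bound on decoding, truncation and
    deviation. *)
Lemma exists_good_code (e : {ffun T -> CA} -> T -> R) t delta :
  (0 < #|ImEns An|)%N -> (0 < #|ImEns Bn|)%N ->
  (forall A x, 0 <= e A x <= 1) -> (forall x, f x <= mu x) -> 0 < t -> 1 <= a ->
  \sum_x mu x * (\sum_(A in An) pA A * e A x) + 2 * (1 - \sum_x f x) +
    ((KA * KB * (b * (1 + a * bA + bB)) + (a ^+ 2 - 1)) / t + t) / 2 < delta ->
  exists A B c, [/\ A \in An, B \in Bn, c \in ImEns An &
    code_error (e A) A B c <= delta].
Proof.
move=> KA0 KB0 e01 fmu t0 a1 bound.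
apply: contrapT => no_code.
have bad A B c : A \in An -> B \in Bn -> c \in ImEns An ->
    delta <= code_error (e A) A B c.
  move=> AAn BBn cA; rewrite leNgt; apply/negP => lt.
  by apply: no_code; exists A, B, c; split=> //; exact: ltW.
have KA0' : 0 < KA by rewrite ltr0n.
have KB0' : 0 < KB by rewrite ltr0n.
have KE : #|bins|%:R = KA * KB by rewrite finset.cardsX natrM.
have bins0 : (0 < #|bins|)%N by rewrite finset.cardsX muln_gt0 KA0.
have f0 x : 0 <= f x by case/andP: (f_bnd x).
set F := \sum_x f x in bound *.
have F0 : 0 <= F by exact: sumr_ge0.
have F1 : F <= 1 by rewrite -mu_sum1; exact: ler_sum.
have lb : delta <= expect (fun A B =>
    \sum_(c in ImEns An) KA^-1 * code_error (e A) A B c).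
  rewrite -[leLHS]expect_cst; apply: expect_le => A B AAn BBn.
  have -> : delta = \sum_(c in ImEns An) KA^-1 * delta.
    by rewrite sumr_const -mulr_natr mulrAC mulVf ?mul1r// gt_eqF.
  by apply: ler_sum => c cA; rewrite ler_wpM2l ?bad// invr_ge0 ltW.
have ub : expect (fun A B => \sum_(c in ImEns An) KA^-1 * code_error (e A) A B c) <=
    expect (fun A B => \sum_x mu x * e A x + 2 * (1 - F) +
      ((2 * t)^-1 * (KA * KB * (\sum_x \sum_(x' | bin A B x == bin A B x') f x * f x'))
       + (t / 2 - F ^+ 2 / (2 * t)))).
  apply: expect_le => A B AAn BBn; rewrite avg_code_error.
  have hI x := mem_bins x AAn BBn.
  apply: (le_trans (avg_cond_error hI bins0 mu_ge0 (e01 A))).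
  rewrite -[leRHS]addrA lerD2l.
  have fmu' x : 0 <= f x <= mu x by rewrite f0 fmu.
  apply: (le_trans (mass_deviation_le hI bins0 fmu' mu_sum1)); rewrite lerD2l.
  apply: (le_trans (mass_deviation hI f bins0 t0)); rewrite KE -/F.
  by rewrite le_eqVlt; apply/predU1P; left; field; rewrite gt_eqF.
rewrite !expectD !expectZ !expect_cst (expect_fst (fun A => \sum_x mu x * e A x)) in ub.
have : delta < delta; last by rewrite ltxx.
apply: le_lt_trans bound; apply: (le_trans lb); apply: (le_trans ub).
have -> : \sum_(A in An) pA A * (\sum_x mu x * e A x) =
    \sum_x mu x * (\sum_(A in An) pA A * e A x).
  under eq_bigr do rewrite mulr_sumr.
  rewrite exchange_big; apply: eq_bigr => x _; rewrite mulr_sumr.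
  by apply: eq_bigr => A _; rewrite mulrCA.
rewrite lerD2l; have := expect_sum_collision; rewrite -/F.
set Q := expect _ => QF.
have b0 : 0 <= b * (1 + a * bA + bB).
  (* The signs of [b], [bA] and [bB] are read off at some [x]; one exists since [mu] sums to 1. *)
  have [x _] : exists x : T, 0 < mu x.
    apply/existsP; apply: contraT; rewrite negb_exists => /forallP mu0.
    have := oner_neq0 R; rewrite -mu_sum1 big1 ?eqxx// => x _.
    by apply/eqP; rewrite eq_le mu_ge0 leNgt mu0.
  have bA0 : 0 <= bA by apply: le_trans (hashA x); exact: hash_sum_ge0.
  have bB0 : 0 <= bB by apply: le_trans (hashB x); exact: hash_sum_ge0.
  rewrite mulr_ge0 ?addr_ge0 ?mulr_ge0//.
  by have /andP[fx0] := f_bnd x; exact: le_trans.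
set E := b * _ in b0 QF *.
have -> : ((KA * KB * E + (a ^+ 2 - 1)) / t + t) / 2 =
   (2 * t)^-1 * (KA * KB * E + (a ^+ 2 - 1) + 0 ) + t / 2 by field; rewrite gt_eqF.
have -> : F ^+ 2 / (2 * t) = (2 * t)^-1 * F ^+ 2 by rewrite mulrC.
rewrite [t / 2 - _]addrC addrA lerD2r -mulrBr addr0.
apply: ler_wpM2l; first by rewrite invr_ge0 mulr_ge0// ltW.
rewrite lerBlDr.
(* The main term [a ^+ 2 * F ^+ 2] cancels against the subtracted [F ^+ 2] up to
   [(a ^+ 2 - 1) * F ^+ 2]; then [F <= 1] removes [F]. *)
have QF' : KA * KB * Q <= KA * KB * (F * E) + a ^+ 2 * F ^+ 2.
  have -> : KA * KB * (F * E) + a ^+ 2 * F ^+ 2 =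
      KA * KB * (F * (E + a ^+ 2 / (KA * KB) * F)) by field; rewrite !gt_eqF.
  by rewrite ler_wpM2l// mulr_ge0// ltW.
have FE : KA * KB * (F * E) <= KA * KB * E.
  by rewrite ler_wpM2l ?ler_piMl// mulr_ge0// ltW.
have : (a ^+ 2 - 1) * F ^+ 2 <= a ^+ 2 - 1.
  by rewrite ler_piMr ?subr_ge0 ?exprn_ege1// expr_le1.
lra.
Qed.

End RandomBinning.

(* The integral of a nonnegative function is a supremum over simple functions,
   hence monotone even on a nonmeasurable domain such as the decoding error set. *)
Lemma ge0_integral_monotone d (T : measurableType d) (R : realType)
    (m : {measure set T -> \bar R}) (D D' : set T) (f g : T -> \bar R) :
  (forall y, 0 <= f y)%E -> (forall y, 0 <= g y)%E ->
  (forall y, D y -> D' y /\ (f y <= g y)%E) ->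
  (\int[m]_(y in D) f y <= \int[m]_(y in D') g y)%E.
Proof.
move=> f0 g0 fg; rewrite integral_mkcond [leRHS]integral_mkcond.
rewrite !ge0_integralTE; first last.
- by move=> y; apply: erestrict_ge0.
- by move=> y; apply: erestrict_ge0.
apply: ereal_sup_le => _ [h hf <-]; exists h => // y.
apply: (le_trans (hf y)); rewrite !patchE.
case: ifPn => [/set_mem/fg[D'y fgy]|_]; first by rewrite (mem_set D'y).
by case: ifP.
Qed.

(** * Decoding error events and their average probability *)

Section Decoding.
Variables (R : realType) (X : finType) (dY : nat -> measure_display)
  (Y : forall n, measurableType (dY n))
  (nu : forall n, {measure set (Y n) -> \bar R})
  (W : forall n, n.-tuple X -> Y n -> R)
  (mu : forall n, n.-tuple X -> R)
  (CA CB : nat -> finType).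
Hypothesis chanW : is_channel nu W.
Hypothesis srcmu : is_source mu.
Variable n : nat.
Local Notation T := (n.-tuple X).
Implicit Types (x : T) (y : Y n) (A : {ffun T -> CA n}) (B : {ffun T -> CB n}).

Let mW x : measurable_fun setT (W x). Proof. by case: (chanW x). Qed.
Let W0 x y : 0 <= W x y. Proof. by case: (chanW x) => _ []. Qed.
Let mu0 x : 0 <= mu x. Proof. by case: (srcmu n). Qed.
Let Wmu0 x y : 0 <= W x y * mu x. Proof. exact: mulr_ge0. Qed.

Let EW0 x y : (0 <= (W x y)%:E)%E. Proof. by rewrite lee_fin. Qed.
Let mEW x D : measurable_fun D (fun y => (W x y)%:E).
Proof. by apply/measurable_EFinP; exact: measurable_funTS. Qed.

(** Real-valued, so that the random-coding sums stay in [R]; by [probE], [fine] loses nothing on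
    measurable sets. *)
Definition prob x (D : set (Y n)) : R := fine (\int[nu n]_(y in D) (W x y)%:E).

Lemma probE x D : measurable D -> (\int[nu n]_(y in D) (W x y)%:E)%E = (prob x D)%:E.
Proof.
move=> mD; rewrite /prob fineK//; have [_ [_ W1]] := chanW x.
rewrite ge0_fin_numE; last exact: integral_ge0.
apply: (@le_lt_trans _ _ (\int[nu n]_y (W x y)%:E)%E); last by rewrite W1 ltry.
exact: ge0_integral_monotone.
Qed.

Lemma prob_bnd x D : measurable D -> 0 <= prob x D <= 1.
Proof.
move=> mD; have [_ [_ W1]] := chanW x.
rewrite -!lee_fin -probE// -W1 integral_ge0//=.
exact: ge0_integral_monotone.
Qed.

(* The events are stated with [W x y * mu x] rather than [muXgY W mu x y], so
   that no division has to be shown measurable. *)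
Definition confused A x : set (Y n) :=
  \bigcup_(x' in [set x' | x' != x /\ A x == A x'])
    [set y | W x y * mu x <= W x' y * mu x'].

Lemma measurable_confused A x : measurable (confused A x).
Proof.
apply: fin_bigcup_measurable => [|x' _]; first exact: finite_finset.
rewrite -[X in measurable X]setTI; apply: (measurable_fun_ler _ _ measurableT) => //.
- by apply: measurable_funM => //; exact: mW.
- by apply: measurable_funM => //; exact: mW.
Qed.

(** The positivity conjunct is needed for [atypicalP]: where the posterior is 0, its inverse and
    [log2] of that are 0 by convention, not infinite. *)
Definition atypical k x : set (Y n) :=
  [set y | 0 < W x y * mu x] `&` [set y | W x y * mu x < muY W mu y * k].

Lemma measurable_atypical k x : measurable (atypical k x).
Proof.
have mWmu x' : measurable_fun setT (fun y => W x' y * mu x').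
  by apply: measurable_funM => //; exact: mW.
apply: measurableI; rewrite -[X in measurable X]setTI.
- by apply: (measurable_fun_ltr _ _ measurableT).
- apply: (measurable_fun_ltr _ _ measurableT) => //.
  by apply: measurable_funM => //; exact: measurable_sum.
Qed.

Lemma atypicalP th x : (0 < n)%N ->
  atypical (expR (- (n%:R * th * ln 2))) x `<=`
  [set y | th < (n%:R)^-1 * log2 (muXgY W mu x y)^-1].
Proof.
move=> n0 y [/= p0 lt].
have n0' : 0 < n%:R :> R by rewrite ltr0n.
have l2 : 0 < ln 2 :> R by rewrite ln_gt0// ltr1n.
rewrite /muXgY invf_div /log2 mulrC ltr_pdivlMr// ltr_pdivlMr//.
rewrite -ltr_expR lnK; last first.
  rewrite posrE divr_gt0//.
  by rewrite -(pmulr_lgt0 _ (expR_gt0 (- (n%:R * th * ln 2)))) (lt_trans p0).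
rewrite ltr_pdivlMr//; move: lt; rewrite expRN ltr_pdivlMr ?expR_gt0//.
by rewrite mulrC [th * _]mulrC.
Qed.

Lemma muXgY_le x x' y : muXgY W mu x y <= muXgY W mu x' y ->
  W x y * mu x <= W x' y * mu x'.
Proof.
have Y0 : 0 <= muY W mu y by exact: sumr_ge0.
(* If [muY] vanishes, all posteriors are 0 by division by zero, but all joint densities vanish
   too. *)
have [Yz _|Yn0] := eqVneq (muY W mu y) 0.
  by rewrite (psumr_eq0P (fun x _ => Wmu0 x y) Yz).
by rewrite /muXgY ler_pM2r// invr_gt0 lt_neqAle eq_sym Yn0.
Qed.

(** Decoding to [x] itself would return [B x = m], so the maximiser is another member of the same
    [A]-bin, at least as likely. Ties count as confusion, so the choice made by [arg max] is
    immaterial. *)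
Lemma psi_confused A B c m x y : x \in CABset A B c m ->
  psi W mu A B c y <> Some m -> confused A x y.
Proof.
rewrite inE => /andP[/eqP Ax /eqP Bx]; rewrite /psi /xA.
case: pickP => [x0 x0A|/(_ x)]; last by rewrite inE Ax eqxx.
case: arg_maxP => //= x' x'A xmax nm; exists x'.
  split; last by move: x'A; rewrite inE Ax eq_sym.
  by apply/eqP => x'x; apply: nm; rewrite x'x Bx.
by apply: muXgY_le; apply: xmax; rewrite inE Ax.
Qed.

(** The error set is enlarged to [confused A x], which is measurable and depends on neither [B] nor
    [c], so averaging over these leaves the decoding term unchanged. *)
Lemma Error_le A B c (Bn : {set {ffun T -> CB n}}) :
  (Error nu W mu A B c (ImEns Bn) <=
   (code_error Bn (@mu n) (fun x => prob x (confused A x)) A B c)%:E)%E.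
Proof.
rewrite /Error /code_error.
have massE m : muset mu (CABset A B c m) = mass (bin A B) (@mu n) (c, m).
  by apply: eq_bigl => x; rewrite inE xpair_eqE.
rewrite big_mkcondr [X in (_ + X)%E]big_mkcondr/= -sumEFin -big_split/= -sumEFin.
apply: lee_sum => m _; rewrite massE; set p := mass _ _ _.
have p0 : 0 <= p by exact: mass_ge0.
move: p p0 => p p0.
case: eqVneq => [->|pn0]; first by rewrite ltxx adde0 mulr1.
rewrite add0e lt_neqAle eq_sym pn0 p0/=.
have k0 x : 0 <= mu x / (#|ImEns Bn|%:R * p) by rewrite divr_ge0// mulr_ge0.
rewrite mulr_suml mulr_sumr -sumEFin.
rewrite (eq_bigl (fun x => bin A B x == (c, m))); last first.
  by move=> x; rewrite inE xpair_eqE.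
apply: lee_sum => x xcm.
have -> : ((#|ImEns Bn|%:R)^-1 * (mu x * prob x (confused A x) / p) =
  mu x / (#|ImEns Bn|%:R * p) * prob x (confused A x)).
  by rewrite invfM; ring.
rewrite EFinM -probE; last exact: measurable_confused.
rewrite -ge0_integralZl ?lee_fin//; [|exact: measurable_confused].
apply: ge0_integral_monotone => y.
- by rewrite lee_fin -mulrA mulr_ge0.
- by rewrite -EFinM lee_fin mulr_ge0.
- move=> err; split; last by rewrite -EFinM lee_fin -mulrA mulrC.
  by apply: psi_confused err; rewrite inE -xpair_eqE.
Qed.

Lemma prob_indic x D : measurable D ->
  (prob x D)%:E = (\int[nu n]_y (W x y * \1_D y)%:E)%E.
Proof.
move=> mD; rewrite -probE// integral_mkcond epatch_indic.
by apply: eq_integral => y _ /=; rewrite EFinM.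
Qed.

Let mWI x D : measurable D -> measurable_fun setT (fun y => W x y * \1_D y).
Proof. by move=> mD; apply: measurable_funM => //; exact: measurable_indic. Qed.

(** Integrates a pointwise bound against the density [W x], of total mass 1; this reduces averaging
    over functions to a fixed output [y]. *)
Lemma sum_prob_le (J : finType) (w : J -> R) (D : J -> set (Y n)) D' x k :
  (forall j, 0 <= w j) -> (forall j, measurable (D j)) -> measurable D' -> 0 <= k ->
  (forall y, 0 < W x y -> \sum_j w j * \1_(D j) y <= \1_D' y + k) ->
  \sum_j w j * prob x (D j) <= prob x D' + k.
Proof.
move=> w0 mD mD' k0 le.
have [_ [_ W1]] := chanW x.
rewrite -lee_fin EFinD -[k%:E]mule1 -W1 -ge0_integralZl ?lee_fin//.
rewrite (prob_indic x mD') -ge0_integralD//; first last.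
- by apply/measurable_EFinP; apply: measurable_funM => //; exact: mW.
- by move=> y _; rewrite -EFinM lee_fin mulr_ge0.
- by apply/measurable_EFinP; exact: mWI.
- by move=> y _; rewrite lee_fin mulr_ge0.
rewrite -sumEFin.
under eq_bigr => j _.
  rewrite EFinM (prob_indic x (mD j)) -ge0_integralZl ?lee_fin//; first last.
  - by move=> y _; rewrite lee_fin mulr_ge0.
  - by apply/measurable_EFinP; exact: mWI.
  over.
rewrite -ge0_integral_sum//; first last.
- by move=> j y _; rewrite -EFinM lee_fin !mulr_ge0.
- move=> j; apply/measurable_EFinP; apply: measurable_funM => //; exact: mWI.
apply: ge0_integral_monotone => y.
- by apply: sume_ge0 => j _; rewrite -EFinM lee_fin !mulr_ge0.
- by rewrite -EFinM -EFinD lee_fin addr_ge0 ?mulr_ge0.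
- move=> _; split=> //; rewrite -EFinM -EFinD.
  under eq_bigr do rewrite -EFinM mulrCA.
  rewrite sumEFin lee_fin -mulr_sumr [k * _]mulrC -mulrDr.
  have [->|Wn0] := eqVneq (W x y) 0; first by rewrite !mul0r.
  by rewrite ler_wpM2l// le// lt_neqAle eq_sym Wn0 W0.
Qed.

(** At an atypical output confusion is bounded by 1; at a typical one, a union bound over the likely
    competitors of [x] is averaged by [sum_pcoll_le]. *)
Lemma avg_prob_confused (An : {set {ffun T -> CA n}}) pA a k bA x :
  is_distr_on An pA -> 0 <= a -> 0 < k ->
  (forall u, hash_sum An pA a u <= bA) -> 0 < mu x ->
  \sum_(A in An) pA A * prob x (confused A x) <=
  prob x (atypical k x) + (a / #|ImEns An|%:R / k + bA).
Proof.
move=> pAP a0 k0 hA mux.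
(* [pA] is a distribution only on [An]; it is extended by 0 to all functions. *)
pose w A := if A \in An then pA A else 0.
have w0 A : 0 <= w A by rewrite /w; case: ifP => // /pAP.1.
have bA0 : 0 <= bA by apply: le_trans (hA x); exact: hash_sum_ge0.
rewrite big_mkcond/=.
rewrite (eq_bigr (fun A => w A * prob x (confused A x))); last first.
  by move=> A _; rewrite /w; case: ifP; rewrite ?mul0r.
have r0 : 0 <= a / #|ImEns An|%:R / k by rewrite !divr_ge0// ltW.
apply: sum_prob_le => //.
- by move=> A; exact: measurable_confused.
- exact: measurable_atypical.
- exact: addr_ge0.
move=> y Wy; have p0 : 0 < W x y * mu x by exact: mulr_gt0.
have w1 : \sum_A w A = 1 by rewrite -big_mkcond pAP.2.
have [aty|naty] := pselect (atypical k x y).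
  rewrite [in leRHS]indicE mem_set//=; apply: (@le_trans _ _ 1); last first.
    by rewrite lerDl addr_ge0.
  by rewrite -w1; apply: ler_sum => A _; rewrite ler_piMr// indicE lern1 leq_b1.
rewrite [in leRHS]indicE memNset//= add0r.
have typ : muY W mu y * k <= W x y * mu x.
  by rewrite leNgt; apply/negP => lt; exact: naty.
pose f x' : R := (W x y * mu x <= W x' y * mu x')%R%:R.
have fb x' : 0 <= f x' <= 1 by rewrite /f ler0n lern1 leq_b1.
(* Each competitor has joint density at least [W x y * mu x], and together they have at most [muY],
   so [typ] bounds their number. *)
have sumf : \sum_x' f x' <= k^-1.
  rewrite -(ler_pM2r p0) ler_pdivlMl// mulr_suml.
  apply: le_trans typ; rewrite mulrC ler_pM2r//; apply: ler_sum => x' _.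
  by rewrite /f; case: (leP (W x y * mu x) (W x' y * _)) => [le|_] /=;
    rewrite ?mulr1n ?mul1r ?mul0r.
have conf A : \1_(confused A x) y <= \sum_(x' | x' != x) f x' * (A x == A x')%:R.
  have nn x' : x' != x -> 0 <= f x' * (A x == A x')%:R.
    by move=> _; case/andP: (fb x') => ? _; rewrite mulr_ge0.
  rewrite indicE; have [/set_mem[x' /= [x'x Axx'] le]|_] := boolP (y \in confused A x).
    rewrite (bigD1 x')//= /f le Axx' mulr1 lerDl.
    by apply: sumr_ge0 => z /andP[zx _]; exact: nn.
  exact: sumr_ge0.
apply: (le_trans (ler_sum _ (fun A _ => ler_wpM2l (w0 A) (conf A)))).
under eq_bigr do rewrite mulr_sumr.
rewrite exchange_big/=.
rewrite (eq_bigr (fun x' => f x' * pcoll An pA x x')); last first.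
  move=> x' _; rewrite /pcoll big_mkcondr mulr_sumr [RHS]big_mkcond/=.
  apply: eq_bigr => A _; rewrite mulrCA /w; case: ifP => _; last by rewrite mul0r mulr0.
  by case: (A x == A x'); rewrite ?mulr1 ?mulr0.
apply: (le_trans (sum_pcoll_le pAP x a0 ler01 fb)); apply: lerD.
  by rewrite ler_wpM2l// divr_ge0.
by rewrite mul1r.
Qed.

Lemma sum_prob_atypical_le th : (0 < n)%N ->
  ((\sum_x mu x * prob x (atypical (expR (- (n%:R * th * ln 2))) x))%:E <=
   @Pjoint R X dY Y nu W mu n (fun x y => (th < (n%:R)^-1 * log2 (muXgY W mu x y)^-1)%R))%E.
Proof.
move=> n0; rewrite -sumEFin; apply: lee_sum => x _.
rewrite EFinM -probE; last exact: measurable_atypical.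
rewrite lee_wpmul2l ?lee_fin//; apply: ge0_integral_monotone => // y aty.
by split=> //; exact: atypicalP.
Qed.

End Decoding.

(** * Exponents, constants and large [n] *)

Lemma log2_rate (R : realType) (k n : nat) (r : R) : (0 < n)%N -> 0 < r ->
  log2 k%:R / n%:R = r -> (0 < k)%N /\ k%:R = expR (n%:R * r * ln 2).
Proof.
(* Since [ln 0 = 0], an empty image would have rate 0, against [0 < r]. *)
move=> n0 r0 kr; have k0 : (0 < k)%N.
  rewrite lt0n; apply/eqP => k0; move: kr r0; rewrite k0 /log2 ln0//.
  by rewrite !mul0r => <-; rewrite ltxx.
split=> //; rewrite -kr /log2 mulrCA mulfV ?pnatr_eq0 -?lt0n// mulr1.
by rewrite divfK ?lnK ?posrE ?ltr0n// gt_eqF// ln_gt0// ltr1n.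
Qed.

Lemma near_expR_le (R : realType) (c e : R) : 0 < c -> 0 < e ->
  \forall n \near \oo, expR (- (n%:R * c)) <= e.
Proof.
move=> c0 e0; near=> n.
rewrite -[leRHS]lnK// ler_expR lerNl -ler_pdivrMr//.
by near: n; exact: nbhs_infty_ger.
Unshelve. all: by end_near. Qed.

Lemma mu_le_expR (R : realType) (n : nat) (th p : R) : (0 < n)%N -> 0 <= p ->
  (n%:R)^-1 * log2 p^-1 < th \/ p <= expR (- (n%:R * th * ln 2)).
Proof.
(* At [p = 0] the logarithm is the default 0, so the right disjunct is proved directly. *)
move=> n0; rewrite le_eqVlt => /predU1P[<-|p0]; first by right; rewrite expR_ge0.
have [lt|le] := ltP ((n%:R)^-1 * log2 p^-1) th; [by left|right].
have n0' : 0 < n%:R :> R by rewrite ltr0n.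
have l2 : 0 < ln 2 :> R by rewrite ln_gt0// ltr1n.
rewrite -[leLHS]lnK ?posrE// ler_expR lerNr -lnV ?posrE//.
by move: le; rewrite /log2 mulrC ler_pdivlMr// ler_pdivlMr// [th * _]mulrC.
Qed.

Theorem theorem1 (R : realType) (X : finType)
  (dY : nat -> measure_display) (Y : forall n, measurableType (dY n))
  (nu : forall n, {measure set (Y n) -> \bar R})
  (W : forall n, n.-tuple X -> Y n -> R)
  (mu : forall n, n.-tuple X -> R)
  (CA CB : nat -> finType)
  (An : forall n, {set {ffun n.-tuple X -> CA n}})
  (pA : forall n, {ffun n.-tuple X -> CA n} -> R)
  (Bn : forall n, {set {ffun n.-tuple X -> CB n}})
  (pB : forall n, {ffun n.-tuple X -> CB n} -> R)
  (r Rr : R) :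
  is_channel nu W -> is_source mu ->
  ensemble An pA -> has_hash_property An pA ->
  ensemble Bn pB -> has_hash_property Bn pB ->
  (forall n, (0 < n)%N -> log2 (#|ImEns (An n)|%:R) / n%:R = r) ->
  (forall n, (0 < n)%N -> log2 (#|ImEns (Bn n)|%:R) / n%:R = Rr) ->
  0 < r -> 0 < Rr ->
  (HsupCond nu W mu < r%:E)%E ->
  ((r + Rr)%:E < Hinf mu)%E ->
  forall delta : R, 0 < delta ->
  exists N : nat, forall n, (N <= n)%N ->
    exists A B c, [/\ A \in An n, B \in Bn n, c \in ImEns (An n) &
      (Error nu W mu A B c (ImEns (Bn n)) <= delta%:E)%E].

Proof.
move=> chanW srcmu ensA [alA [beA [alA1 [beA0 hashA]]]]
  ensB [alB [beB [alB1 [beB0 hashB]]]] rateA rateB r0 Rr0.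
move=> /ereal_inf_lt[_ [th Pth <-]]; rewrite lte_fin => th_r.
move=> /ereal_sup_gt[_ [th2 Pth2 <-]]; rewrite lte_fin => r_th2.
move=> delta delta0.
have l2 : 0 < ln 2 :> R by rewrite ln_gt0// ltr1n.
pose t := delta / 4.
have t0 : 0 < t by rewrite divr_gt0.
(* Budget: [4 * e] for decoding and [2 * e] for truncation, together at most [delta / 4], and
   [t = delta / 4] for the deviation. *)
pose e := Num.min 1 (Num.min (delta / 24) (t ^+ 2 / 7)).
have e0 : 0 < e by rewrite !lt_min ltr01 !divr_gt0// exprn_gt0.
have e1 : e <= 1 by rewrite ge_min lexx.
have ed : e <= delta / 24 by rewrite !ge_min lexx orbT.
have et : 7 * e <= t ^+ 2.
  by rewrite mulrC -ler_pdivlMr// !ge_min lexx !orbT.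
have a1 : 1 <= 1 + e by rewrite lerDl ltW.
have a1' : 1 < 1 + e by rewrite ltrDl.
have [Pfin Pfine] := (fine_cvgP _ _).1 Pth.
have : \forall n \near \oo, [/\ (0 < n)%N,
    [/\ alA n <= 1 + e, beA n <= e, alB n <= 1 + e & beB n <= e],
    (@Pjoint R X dY Y nu W mu n
      (fun x y => (th < (n%:R)^-1 * log2 (muXgY W mu x y)^-1)%R) <= e%:E)%E,
    \sum_(x | (n%:R)^-1 * log2 (mu n x)^-1 < th2) mu n x <= e &
    expR (- (n%:R * ((r - th) * ln 2))) <= e /\
    expR (- (n%:R * ((th2 - (r + Rr)) * ln 2))) <= e].
  near=> n; split; [| | | |split].
  - by near: n; exact: nbhs_infty_gt.
  - split; near: n; [exact: cvgr_le alA1 _ a1'|exact: cvgr_le beA0 _ e0|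
                     exact: cvgr_le alB1 _ a1'|exact: cvgr_le beB0 _ e0].
  - have fin := near Pfin n; rewrite -[leLHS]fineK ?lee_fin; last exact: fin.
    by near: n; exact: cvgr_le Pfine _ e0.
  - by near: n; exact: cvgr_le Pth2 _ e0.
  - by near: n; apply: near_expR_le => //; rewrite mulr_gt0// subr_gt0.
  - by near: n; apply: near_expR_le => //; rewrite mulr_gt0// subr_gt0.
move=> [N _ HN]; exists N => n /HN[n0 [haA hbA haB hbB] hP hF [hr hth2]].
have [mu0 mu1] := srcmu n.
have [KA0 KA] := log2_rate n0 r0 (rateA n n0).
have [KB0 KB] := log2_rate n0 Rr0 (rateB n n0).
pose k := expR (- (n%:R * th * ln 2)).
pose b := expR (- (n%:R * th2 * ln 2)).
(* Cutting by the event of [Hinf] makes the lost mass the probability that tends to 0. *)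
pose f x := if (n%:R)^-1 * log2 (mu n x)^-1 < th2 then 0 else mu n x.
have f_mu x : f x <= mu n x by rewrite /f; case: ifP.
have fb x : 0 <= f x <= b.
  rewrite /f; case: ltP => [_|le]; first by rewrite lexx expR_ge0.
  rewrite mu0/=; have [|//] := mu_le_expR th2 n0 (mu0 x).
  by rewrite ltNge le.
have sumf : 1 - \sum_x f x <= e.
  rewrite -mu1 -sumrB; apply: le_trans hF; rewrite [leRHS]big_mkcond/=.
  by apply: ler_sum => x _; rewrite /f; case: ifP; rewrite ?subr0 ?subrr.
have hA u : hash_sum (An n) (pA n) (1 + e) u <= e.
  by apply: le_trans hbA; apply: le_trans (hashA n u); exact: hash_sum_le.
have hB u : hash_sum (Bn n) (pB n) (1 + e) u <= e.
  by apply: le_trans hbB; apply: le_trans (hashB n u); exact: hash_sum_le.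
pose err (A : {ffun n.-tuple X -> CA n}) x := prob nu W x (confused W mu A x).
have err01 A x : 0 <= err A x <= 1.
  by apply: (prob_bnd chanW); exact: measurable_confused.
(* One [e] for atypical outputs, [2 * e] for competitors (from [th < r]), one [e] for bad
   collisions. *)
have sum_err : \sum_x mu n x * (\sum_(A in An n) pA n A * err A x) <= 4 * e.
  have le x : mu n x * (\sum_(A in An n) pA n A * err A x) <=
      mu n x * prob nu W x (atypical W mu k x) + mu n x * (3 * e).
    rewrite -mulrDr; have [->|mun0] := eqVneq (mu n x) 0; first by rewrite !mul0r.
    have mux : 0 < mu n x by rewrite lt_neqAle eq_sym mun0 mu0.
    rewrite ler_wpM2l//.
    apply: (le_trans (avg_prob_confused chanW srcmu (ensA n) (le_trans ler01 a1)
      (expR_gt0 (- (n%:R * th * ln 2))) hA mux)).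
    rewrite lerD2l -mulrA -invfM KA -expRD -expRN.
    have -> : - (n%:R * r * ln 2 + - (n%:R * th * ln 2)) =
      - (n%:R * ((r - th) * ln 2)) by ring.
    suff : (1 + e) * expR (- (n%:R * ((r - th) * ln 2))) <= 2 * e by lra.
    by apply: ler_pM; rewrite ?expR_ge0//; lra.
  apply: (le_trans (ler_sum _ (fun x _ => le x))).
  rewrite big_split/= -mulr_suml mu1 mul1r.
  suff : \sum_x mu n x * prob nu W x (atypical W mu k x) <= e by lra.
  by rewrite -lee_fin; apply: le_trans hP; exact: sum_prob_atypical_le.
have [|A [B [c [AAn BBn cIm le]]]] := @exists_good_code R X n (CA n) (CB n)
  (An n) (pA n) (Bn n) (pB n) (ensA n) (ensB n) f (1 + e) b e e fb
  (le_trans ler01 a1) hA hB (mu n) mu0 mu1 err t delta KA0 KB0 err01 f_mu t0 a1.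
  have Kb : #|ImEns (An n)|%:R * #|ImEns (Bn n)|%:R * b <= e.
    rewrite KA KB -!expRD.
    have -> : n%:R * r * ln 2 + n%:R * Rr * ln 2 + - (n%:R * th2 * ln 2) =
      - (n%:R * ((th2 - (r + Rr)) * ln 2)) by ring.
    exact: hth2.
  have ee : e * e <= e by rewrite ler_piMl// ltW.
  (* The [7] in [et]: [4 * e] from [Kb], as the bracket is at most 4, plus [3 * e] from
     [(1 + e) ^+ 2 - 1]. *)
  have V : #|ImEns (An n)|%:R * #|ImEns (Bn n)|%:R * (b * (1 + (1 + e) * e + e)) +
      ((1 + e) ^+ 2 - 1) <= t * t.
    rewrite -expr2; apply: le_trans et; rewrite mulrA.
    have : #|ImEns (An n)|%:R * #|ImEns (Bn n)|%:R * b * (1 + (1 + e) * e + e) <= e * 4.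
      apply: ler_pM => //; [by rewrite !mulr_ge0 ?ler0n ?expR_ge0|nra|nra].
    by nra.
  have : (#|ImEns (An n)|%:R * #|ImEns (Bn n)|%:R * (b * (1 + (1 + e) * e + e)) +
      ((1 + e) ^+ 2 - 1)) / t <= t by rewrite ler_pdivrMr.
  by move: sum_err sumf; rewrite /t in ed *; lra.
exists A, B, c; split=> //.
apply: (le_trans (Error_le chanW srcmu A B c (Bn n))).
by rewrite lee_fin.
Unshelve. all: by end_near. Qed.
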